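(* Let $G$ be a marked graph equipped with its natural cell structure, let $\gamma\colon C\to G$ be a circuit family, let $v\in G$ be a vertex, and let $\{\widehat W_1,\widehat W_2\}$ be a cut of the augmented Whitehead graph $\widehat W_v\gamma$ along some direction $d\in W_v\gamma$. Let $H$ be the marked graph obtained by splitting $G$ along $d$ using the cut $\{\widehat W_1,\widehat W_2\}$, and let $f\colon H\to G$ be the corresponding fold map. Then there exists a unique circuit family $\delta\colon C\to H$ with the following properties: (1) $\delta$ does not take the illegal turn of $f$; (2) the circuit family $f\circ\delta\colon C\to G$ is equivalent to $\gamma$. Furthermore, there is a strict inequality of natural weight sequences: (3) $w(\delta)<w(\gamma)$. The constructions of $H$, of $f\colon H\to G$, and of $\delta$ are algorithmic given the input $G$, $\gamma$, and $\{\widehat W_1,\widehat W_2\}$.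
   Context: Graphs are 1-dimensional CW complexes. A core graph is a finite connected graph with no valence 1 vertices; a marked graph of rank $n\ge2$ is a core graph $G$ of rank $n$ (rank of $\pi_1$) with a homotopy equivalence (marking) $R_n\to G$ from the rank $n$ rose. The natural cell structure has as vertices the points of valence $\ge 3$; its edges are the natural edges. $\overline E$ is the reversal of an oriented edge $E$. Circuit families. A circuit family is an immersion (locally injective continuous map) $\gamma\colon C\to G$, where $C$ is a finite disjoint union of oriented circles, such that the restrictions to distinct components are inequivalent; circuits are equivalent if they differ by precomposition with an orientation preserving homeomorphism, and circuit families are considered up to such equivalence on components. Directions and Whitehead graphs. $T_vG$ is the set of directions at $v$: germs $dE$ of oriented edges $E$ with initial vertex $v$. A turn at $v$ is a 2-element subset of $T_vG$; $\gamma$ takes the turn $\{dE,dE'\}$ if $\overline E E'$ or $\overline{E'}E$ is a subpath of $\gamma$. The Whitehead graph $W_v\gamma$ is the simplicial graph whose vertices are the directions $dE\in T_vG$ such that $\gamma$ crosses $E$, and whose edges are the turns at $v$ taken by $\gamma$. The augmented Whitehead graph is $\widehat W_v\gamma=W_v\gamma\cup T_vG$. A cut of $\widehat W_v\gamma$ along $d\in W_v\gamma$ is a pair of subgraphs $\widehat W_1,\widehat W_2$ with $\widehat W_v\gamma=\widehat W_1\cup\widehat W_2$, $\widehat W_1\cap\widehat W_2=\{d\}$, and each $\widehat W_i$ containing at least one edge incident to $d$. Splitting. Put $T_i=\widehat W_i\cap T_vG$, so $T_1\cup T_2=T_vG$, $T_1\cap T_2=\{d\}$. Let $E$ be the oriented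 natural edge with terminal vertex $v$ and $d\overline E=d$; let $u$ be its initial vertex. Case $u\ne v$: $H$ is obtained from $G$ by detaching all directions from $v$, removing the interior of $E$ and the vertex $v$ (keeping $u$), adding two new vertices $v_1,v_2$ and two new oriented edges $E_1,E_2$ both with initial vertex $u$ and with terminal vertices $v_1,v_2$ respectively, and reattaching the directions in $T_i-\{d\}$ to $v_i$ ($i=1,2$). Case $u=v$: index so that $dE\in T_1-\{d\}$. Detach all directions from $v$, remove the interior of $E$ and $v$, add vertices $v_1,v_2$ and oriented edges $E_1,E_2$ both with initial vertex $v_1$ and with terminal vertices $v_1,v_2$ respectively, reattach the directions in $T_1-\{d,dE\}$ to $v_1$ and those in $T_2-\{d\}$ to $v_2$. In both cases $f\colon H\to G$ is the simplicial quotient map with $f(v_1)=f(v_2)=v$, $f(E_1)=f(E_2)=E$, and no other identifications; it is a homotopy equivalence, and $H$ is marked by composing the marking of $G$ with a homotopy inverse of $f$. The illegal turn of $f$ is $\{dE_1,dE_2\}$. Weight sequences. For a circuit family $\gamma$ in $G$ and a natural edge $e$, let $k(e,\gamma)$ be the number of times $\gamma$ crosses $e$, i.e. $|\gamma^{-1}(x)|$ for $x$ in the interior of $e$. The natural weight sequence is $w(\gamma)=(w_0(\gamma),w_1(\gamma),\dots)$, where $w_k(\gamma)$ is the number of natural edges $e$ of $G$ with $k(e,\gamma)=k$. (For $\delta$, use the natural edges of $H$.) Sequences of natural numbers with finitely many nonzero terms are ordered by $(w_i)<(w_i')$ if there is $k$ with $w_i=w'_i$ for all $i>k$ and $w_k<w'_k$.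 *)

(* Defs.v *)
From mathcomp Require Import all_boot.

Set Implicit Arguments.
Unset Strict Implicit.
Unset Printing Implicit Defensive.

(* A finite 1-dimensional CW complex: every 1-cell has a characteristic map,
   hence a preferred orientation. *)
Record graph := Graph {
  vert : finType;
  edge : finType;
  src : edge -> vert;
  tgt : edge -> vert }.

(* Oriented edges: (e, true) is e with its preferred orientation, (e, false)
   its reversal. *)
Notation dart G := (edge G * bool)%type.

Definition bar (G : graph) (a : dart G) : dart G := (a.1, ~~ a.2).

Definition ini (G : graph) (a : dart G) : vert G :=
  if a.2 then src a.1 else tgt a.1.

Definition ter (G : graph) (a : dart G) : vert G := ini (bar a).

(* The direction (germ) of an oriented edge is represented by the oriented
   edge itself; both ends of a loop at x contribute to T_x. *)
Definition directions (G : graph) (x : vert G) : {set dart G} :=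
  [set a | ini a == x].

Definition valence (G : graph) (x : vert G) : nat := #|directions x|.

Fixpoint is_path (G : graph) (x : vert G) (p : seq (dart G)) (y : vert G) :=
  if p is a :: p' then (ini a == x) && is_path (ter a) p' y else x == y.

Definition core_graph (G : graph) : Prop :=
  (forall x y : vert G, exists p, is_path x p y) /\
  (forall x : vert G, valence x != 1).

Definition natural_vertex (G : graph) (x : vert G) : bool := 2 < valence x.

Definition natural_structure (G : graph) : Prop :=
  forall x : vert G, natural_vertex x.

Definition inv_path (G : graph) (p : seq (dart G)) : seq (dart G) :=
  rev (map (@bar G) p).

(* Homotopy of edge paths relative to their endpoints. *)
Inductive path_homotopic (G : graph) : seq (dart G) -> seq (dart G) -> Prop :=
| ph_refl p : path_homotopic p p
| ph_sym p q : path_homotopic p q -> path_homotopic q p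
| ph_trans p q r :
    path_homotopic p q -> path_homotopic q r -> path_homotopic p r
| ph_cancel p a q : path_homotopic (p ++ a :: bar a :: q) (p ++ q).

(* Vertices go to vertices and edges to edge paths, possibly trivial or
   not reduced. *)
Record graph_map (G H : graph) := GraphMap {
  vmap : vert G -> vert H;
  emap : edge G -> seq (dart H);
  emapP : forall e, is_path (vmap (src e)) (emap e) (vmap (tgt e)) }.

Definition dmap (G H : graph) (f : graph_map G H) (a : dart G) :=
  if a.2 then emap f a.1 else inv_path (emap f a.1).

Definition push_path (G H : graph) (f : graph_map G H) (p : seq (dart G)) :
  seq (dart H) := flatten (map (dmap f) p).

(* h x is the track of the vertex x under the homotopy. *)
Definition homotopic (G H : graph) (f g : graph_map G H) : Prop :=
  exists2 h : vert G -> seq (dart H),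
    forall x, is_path (vmap f x) (h x) (vmap g x) &
    forall e, path_homotopic (emap f e ++ h (tgt e)) (h (src e) ++ emap g e).

Lemma is_path_cat (G : graph) (x z : vert G) p y q :
  is_path x p y -> is_path y q z -> is_path x (p ++ q) z.
Proof.
by elim: p x => [|a p IH] x /= => [/eqP->|/andP[-> /IH H]] //= /H.
Qed.

Lemma barK (G : graph) : involutive (@bar G).
Proof. by case=> e b; rewrite /bar /= negbK. Qed.

Lemma inv_path_cons (G : graph) a (p : seq (dart G)) :
  inv_path (a :: p) = inv_path p ++ [:: bar a].
Proof. by rewrite /inv_path /= rev_cons -cats1. Qed.

Lemma inv_path_cat (G : graph) (p q : seq (dart G)) :
  inv_path (p ++ q) = inv_path q ++ inv_path p.
Proof. by rewrite /inv_path map_cat rev_cat. Qed.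

Lemma inv_pathK (G : graph) : involutive (@inv_path G).
Proof.
move=> p; rewrite /inv_path map_rev revK -map_comp -[RHS]map_id.
by apply: eq_map => a /=; rewrite barK.
Qed.

Lemma is_path_rev (G : graph) (x y : vert G) p :
  is_path x p y -> is_path y (inv_path p) x.
Proof.
elim: p x => [|a p IH] x /=; first by rewrite eq_sym.
case/andP=> /eqP <- /IH H; rewrite inv_path_cons.
by apply: is_path_cat H _; rewrite /= /ter barK !eqxx.
Qed.

Lemma dmapP (G H : graph) (f : graph_map G H) a :
  is_path (vmap f (ini a)) (dmap f a) (vmap f (ter a)).
Proof.
case: a => e []; rewrite /dmap /ter /ini /=; first exact: emapP.
by apply: is_path_rev; exact: emapP.
Qed.

Lemma push_pathP (G H : graph) (f : graph_map G H) x p y :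
  is_path x p y -> is_path (vmap f x) (push_path f p) (vmap f y).
Proof.
elim: p x => [|a p IH] x /=; first by move/eqP->.
by case/andP=> /eqP <- /IH; apply: is_path_cat; exact: dmapP.
Qed.

Lemma graph_id_ok (G : graph) (e : edge G) :
  is_path (src e) [:: (e, true)] (tgt e).
Proof. by rewrite /= /ter /ini /= !eqxx. Qed.

Definition graph_id (G : graph) : graph_map G G :=
  @GraphMap G G id (fun e => [:: (e, true)]) (@graph_id_ok G).

Lemma graph_comp_ok (G H K : graph) (g : graph_map H K) (f : graph_map G H) e :
  is_path (vmap g (vmap f (src e))) (push_path g (emap f e))
          (vmap g (vmap f (tgt e))).
Proof. by apply: push_pathP; exact: emapP. Qed.

Definition graph_comp (G H K : graph) (g : graph_map H K) (f : graph_map G H) :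
  graph_map G K :=
  @GraphMap G K (vmap g \o vmap f) (fun e => push_path g (emap f e))
    (graph_comp_ok g f).

Definition homotopy_inverse (G H : graph)
    (f : graph_map G H) (g : graph_map H G) : Prop :=
  homotopic (graph_comp g f) (graph_id G) /\ homotopic (graph_comp f g) (graph_id H).

Definition homotopy_equivalence (G H : graph) (f : graph_map G H) : Prop :=
  exists g, homotopy_inverse f g.

Definition rose (n : nat) : graph :=
  @Graph unit 'I_n (fun=> tt) (fun=> tt).

(* The marking forces the fundamental group to be free of rank n. *)
Record marked_graph (n : nat) := MarkedGraph {
  underlying :> graph;
  marking : graph_map (rose n) underlying;
  marked_core : core_graph underlying;
  marking_equiv : homotopy_equivalence marking }.

(* Up to an orientation preserving reparametrization, an immersion of an
   oriented circle is a nonempty cyclic edge path without backtracking. *)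
Definition circuit (G : graph) (c : seq (dart G)) : bool :=
  (c != [::]) && cycle (fun a b => (ter a == ini b) && (b != bar a)) c.

Definition circuit_equiv (G : graph) (c c' : seq (dart G)) : Prop :=
  exists k, c' = rot k c.

(* The finite type C indexes the components of the disjoint union of
   circles. *)
Definition circuit_family (G : graph) (C : finType)
    (gamma : C -> seq (dart G)) : Prop :=
  (forall i, circuit (gamma i)) /\
  (forall i j, i != j -> ~ circuit_equiv (gamma i) (gamma j)).

Definition family_equiv (G : graph) (C : finType)
    (gamma gamma' : C -> seq (dart G)) : Prop :=
  forall i, circuit_equiv (gamma i) (gamma' i).

Definition crosses (G : graph) (C : finType) (gamma : C -> seq (dart G))
    (a : dart G) : bool :=
  [exists i, (a \in gamma i) || (bar a \in gamma i)].

(* (a, b) is a subpath of the cyclic path c; when c = [:: a] this includes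
   (a, a). *)
Definition cyclic_subpath2 (G : graph) (c : seq (dart G)) (a b : dart G) :=
  (a, b) \in zip c (rot 1 c).

Definition takes_turn (G : graph) (C : finType) (gamma : C -> seq (dart G))
    (a b : dart G) : bool :=
  [exists i, cyclic_subpath2 (gamma i) (bar a) b
          || cyclic_subpath2 (gamma i) (bar b) a].

Record sgraph (T : finType) := SGraph {
  sverts : {set T};
  sedges : {set {set T}} }.

Definition sunion (T : finType) (A B : sgraph T) : sgraph T :=
  SGraph (sverts A :|: sverts B) (sedges A :|: sedges B).

Definition sinter (T : finType) (A B : sgraph T) : sgraph T :=
  SGraph (sverts A :&: sverts B) (sedges A :&: sedges B).

Definition subgraph (T : finType) (A B : sgraph T) : Prop :=
  [/\ sverts A \subset sverts B, sedges A \subset sedges B &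
      forall t, t \in sedges A -> t \subset sverts A].

Definition whitehead (G : graph) (C : finType) (gamma : C -> seq (dart G))
    (v : vert G) : sgraph (dart G) :=
  SGraph [set a in directions v | crosses gamma a]
    [set t | [exists a in directions v, exists b in directions v,
                [&& a != b, t == [set a; b] & takes_turn gamma a b]]].

Definition aug_whitehead (G : graph) (C : finType) (gamma : C -> seq (dart G))
    (v : vert G) : sgraph (dart G) :=
  sunion (whitehead gamma v) (SGraph (directions v) set0).

Record is_cut (G : graph) (C : finType) (gamma : C -> seq (dart G))
    (v : vert G) (d : dart G) (W1 W2 : sgraph (dart G)) : Prop := IsCut {
  cut_dir : d \in sverts (whitehead gamma v);
  cut_sub1 : subgraph W1 (aug_whitehead gamma v);
  cut_sub2 : subgraph W2 (aug_whitehead gamma v);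
  cut_union : aug_whitehead gamma v = sunion W1 W2;
  cut_inter : sinter W1 W2 = SGraph [set d] set0;
  cut_edge1 : exists2 t, t \in sedges W1 & d \in t;
  cut_edge2 : exists2 t, t \in sedges W2 & d \in t }.

(* Here v = ini d, and E = bar d terminates at v.  In the split graph the
   vertex v_1 is Some v and v_2 is None, the edge E_1 is Some d.1 and E_2 is
   None (oriented as d.1).  split_attach d T2 a is the new initial vertex of an
   oriented edge a of G: v_2 if a lies in T_2 - {d}; v_1 if a lies in T_1; and
   the old vertex if a is not a direction at v.  It is applied to a = d to
   obtain the terminal vertex v_1 of E_1, and to a = bar d to obtain the common
   initial vertex of E_1 and E_2.  That vertex is u when u <> v, and the
   vertex v_i with dE in T_i when u = v (up to indexing, i = 1). *)
Definition split_attach (G : graph) (d : dart G) (T2 : {set dart G})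
    (a : dart G) : option (vert G) :=
  if [&& ini a == ini d, a != d & a \in T2] then None else Some (ini a).

Definition split_end (G : graph) (d : dart G) (T2 : {set dart G})
    (e : option (edge G)) (b : bool) : option (vert G) :=
  match e with
  | Some e => split_attach d T2 (e, b)
  | None => if b == d.2 then None else split_attach d T2 (bar d)
  end.

Definition split_graph (G : graph) (d : dart G) (T2 : {set dart G}) : graph :=
  @Graph (option (vert G)) (option (edge G))
    (fun e => split_end d T2 e true) (fun e => split_end d T2 e false).

(* The oriented edges E_1 and E_2, which form the illegal turn. *)
Definition split_E1 (G : graph) (d : dart G) (T2 : {set dart G}) :
  dart (split_graph d T2) := (Some d.1, ~~ d.2).

Definition split_E2 (G : graph) (d : dart G) (T2 : {set dart G}) :
  dart (split_graph d T2) := (None, ~~ d.2).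

Lemma ini_split (G : graph) (d : dart G) T2 (a : dart (split_graph d T2)) :
  ini a = split_end d T2 a.1 a.2.
Proof. by case: a => e []. Qed.

Lemma odflt_attach (G : graph) (d : dart G) T2 a :
  odflt (ini d) (split_attach d T2 a) = ini a.
Proof. by rewrite /split_attach; case: ifP => // /and3P[/eqP->]. Qed.

Lemma fold_ok (G : graph) (d : dart G) T2 (e : edge (split_graph d T2)) :
  is_path (odflt (ini d) (src e)) [:: (odflt d.1 e, true)]
          (odflt (ini d) (tgt e)).
Proof.
case: e => [e|] /=; rewrite ?odflt_attach ?eqxx //.
by case: d => e0 [] /=; rewrite odflt_attach /= !eqxx.
Qed.

(* The fold map f : H -> G. *)
Definition fold_map (G : graph) (d : dart G) (T2 : {set dart G}) :
  graph_map (split_graph d T2) G :=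
  @GraphMap (split_graph d T2) G (odflt (ini d))
    (fun e => [:: (odflt d.1 e, true)]) (@fold_ok G d T2).

(* The homotopy inverse of f sends v to v_1, E to E_1, and precedes each
   direction of T_2 - {d} by the path from v_1 to v_2 across E_1 and E_2. *)
Definition split_bridge (G : graph) (d : dart G) (T2 : {set dart G})
    (x : option (vert G)) : seq (dart (split_graph d T2)) :=
  if x is None then [:: bar (split_E1 d T2); split_E2 d T2] else [::].

Definition split_edge (G : graph) (d : dart G) (T2 : {set dart G})
    (e : edge G) : seq (dart (split_graph d T2)) :=
  split_bridge d T2 (split_attach d T2 (e, true)) ++ [:: (Some e, true)]
    ++ inv_path (split_bridge d T2 (split_attach d T2 (e, false))).

Lemma attach_d (G : graph) (d : dart G) T2 :
  split_attach d T2 d = Some (ini d).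
Proof. by rewrite /split_attach !eqxx. Qed.

Lemma split_bridgeP (G : graph) (d : dart G) T2 x :
  is_path (G := split_graph d T2)
          (Some (odflt (ini d) x)) (split_bridge d T2 x) x.
Proof.
case: x => [x|] //=.
rewrite /ter !ini_split /= !negbK -surjective_pairing attach_d !eqxx /= andbT.
by case: d => e []; rewrite /= eqxx.
Qed.

Lemma split_edge_ok (G : graph) (d : dart G) T2 e :
  is_path (G := split_graph d T2)
          (Some (src e)) (split_edge d T2 e) (Some (tgt e)).
Proof.
have H b := split_bridgeP d T2 (split_attach d T2 (e, b)).
move: (H true) (H false); rewrite !odflt_attach => H1 H2.
apply: is_path_cat H1 _; apply: is_path_cat (is_path_rev H2).
by rewrite /= /ter !ini_split /= !eqxx.
Qed.

Definition unfold_map (G : graph) (d : dart G) (T2 : {set dart G}) :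
  graph_map G (split_graph d T2) :=
  @GraphMap G (split_graph d T2) Some (split_edge d T2)
    (@split_edge_ok G d T2).

Lemma ph_cons (G : graph) a (p q : seq (dart G)) :
  path_homotopic p q -> path_homotopic (a :: p) (a :: q).
Proof.
elim=> [r|r s _ /ph_sym|r s t _ H1 _ H2|r b s] //.
- exact: ph_refl.
- exact: ph_trans H1 H2.
- exact: (ph_cancel (a :: r)).
Qed.

Lemma ph_catl (G : graph) (r p q : seq (dart G)) :
  path_homotopic p q -> path_homotopic (r ++ p) (r ++ q).
Proof. by elim: r => //= a r IH /IH /ph_cons. Qed.

Lemma ph_catr (G : graph) (r p q : seq (dart G)) :
  path_homotopic p q -> path_homotopic (p ++ r) (q ++ r).
Proof.
elim=> [s|s t _ /ph_sym|s t u _ H1 _ H2|s b t] //.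
- exact: ph_refl.
- exact: ph_trans H1 H2.
- by rewrite -!catA; exact: ph_cancel.
Qed.

Lemma ph_rev_r (G : graph) (p : seq (dart G)) :
  path_homotopic (p ++ inv_path p) [::].
Proof.
elim: p => [|a p IH]; first exact: ph_refl.
rewrite inv_path_cons /= catA.
apply: ph_trans (ph_cancel [::] a [::]).
by apply: ph_cons; exact: (ph_catr [:: bar a] IH).
Qed.

Lemma ph_rev_l (G : graph) (p : seq (dart G)) :
  path_homotopic (inv_path p ++ p) [::].
Proof. by rewrite -{2}[p]inv_pathK; exact: ph_rev_r. Qed.

Lemma push_path_cat (G H : graph) (f : graph_map G H) p q :
  push_path f (p ++ q) = push_path f p ++ push_path f q.
Proof. by rewrite /push_path map_cat flatten_cat. Qed.

Lemma dmap_bar (G H : graph) (f : graph_map G H) a :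
  dmap f (bar a) = inv_path (dmap f a).
Proof. by case: a => e []; rewrite /dmap //= inv_pathK. Qed.

Lemma push_path_rev (G H : graph) (f : graph_map G H) p :
  push_path f (inv_path p) = inv_path (push_path f p).
Proof.
elim: p => //= a p IH.
rewrite inv_path_cons push_path_cat IH [push_path f (a :: p)]/= inv_path_cat.
by rewrite /push_path /= cats0 dmap_bar.
Qed.

Lemma ph_push_path (G H : graph) (f : graph_map G H) p q :
  path_homotopic p q -> path_homotopic (push_path f p) (push_path f q).
Proof.
elim=> [s|s t _ /ph_sym|s t u _ H1 _ H2|s b t] //.
- exact: ph_refl.
- exact: ph_trans H1 H2.
- rewrite !push_path_cat; apply: ph_catl.
  rewrite /push_path /= catA dmap_bar.
  exact: (ph_catr _ (ph_rev_r _)).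
Qed.

Lemma push_path_comp (G H K : graph) (g : graph_map H K) (f : graph_map G H) p :
  push_path (graph_comp g f) p = push_path g (push_path f p).
Proof.
elim: p => //= -[e b] p IH.
rewrite /push_path /= -!/(push_path _ _) push_path_cat IH; congr (_ ++ _).
by case: b => //=; rewrite /dmap /= push_path_rev.
Qed.

Lemma push_path_id (G : graph) p : push_path (graph_id G) p = p.
Proof. by elim: p => //= -[e []] p IH; rewrite -[RHS]/(_ :: p) -{2}IH. Qed.

Lemma homotopic_path (G H : graph) (f g : graph_map G H) h :
  (forall e, path_homotopic (emap f e ++ h (tgt e)) (h (src e) ++ emap g e)) ->
  forall x p y, is_path x p y ->
  path_homotopic (push_path f p ++ h y) (h x ++ push_path g p).
Proof.
move=> Hh x p y; elim: p x => [|a p IH] x /=.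
  by move/eqP->; rewrite cats0; exact: ph_refl.
case/andP=> /eqP <- /IH {}IH.
have Ha : path_homotopic (dmap f a ++ h (ter a)) (h (ini a) ++ dmap g a).
  case: a {IH} => e [] /=; rewrite /dmap /ter /ini /=; first exact: Hh.
  set p1 := emap f e; set p2 := emap g e.
  have H1 : path_homotopic (inv_path p1 ++ h (src e))
      (inv_path p1 ++ (h (src e) ++ (p2 ++ inv_path p2))).
    apply: ph_catl; rewrite -{1}[h _]cats0.
    by apply/ph_catl/ph_sym/ph_rev_r.
  apply: ph_trans H1 _; rewrite !catA; apply: ph_catr.
  apply: ph_trans (ph_catr _ (ph_rev_l p1)).
  by rewrite -!catA; apply: ph_catl; apply: ph_sym; exact: Hh.
rewrite /push_path /= -!/(push_path _ _) -catA.
apply: ph_trans (ph_catl _ IH) _.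
by rewrite !catA; exact: ph_catr.
Qed.

Lemma homotopic_trans (G H : graph) (f g k : graph_map G H) :
  homotopic f g -> homotopic g k -> homotopic f k.
Proof.
case=> h Hh1 Hh2 [h' Hh1' Hh2']; exists (fun x => h x ++ h' x) => [x|e].
  exact: is_path_cat (Hh1 x) (Hh1' x).
rewrite catA; apply: ph_trans (ph_catr _ (Hh2 e)) _.
by rewrite -!catA; exact: ph_catl.
Qed.

(* The two inner maps of a fourfold composite cancel up to homotopy. *)
Lemma homotopic_inner (G H K : graph) (f : graph_map G H) (f' : graph_map H K)
    (g : graph_map H H) :
  homotopic g (graph_id H) ->
  homotopic (graph_comp f' (graph_comp g f)) (graph_comp f' f).
Proof.
case=> h Hh1 Hh2; exists (fun x => push_path f' (h (vmap f x))) => [x|e] /=.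
  exact/push_pathP/Hh1.
rewrite -!push_path_cat; apply: ph_push_path.
have := homotopic_path Hh2 (emapP f e).
by rewrite push_path_id.
Qed.

Lemma homotopic_ext (G H : graph) (f f' g : graph_map G H) :
  vmap f =1 vmap f' -> emap f =1 emap f' -> homotopic f g -> homotopic f' g.
Proof.
move=> Hv He [h Hh1 Hh2]; exists h => [x|e]; first by rewrite -Hv.
by rewrite -He.
Qed.

Lemma homotopy_inverse_comp (G H K : graph) (f : graph_map G H)
    (f' : graph_map H G) (g : graph_map H K) (g' : graph_map K H) :
  homotopy_inverse f f' -> homotopy_inverse g g' ->
  homotopy_inverse (graph_comp g f) (graph_comp f' g').
Proof.
move=> [Hf1 Hf2] [Hg1 Hg2]; split.
- apply: homotopic_trans Hf1.
  apply: homotopic_ext (homotopic_inner f f' Hg1) => // e /=.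
  by rewrite !push_path_comp.
- apply: homotopic_trans Hg2.
  apply: homotopic_ext (homotopic_inner g' g Hf2) => // e /=.
  by rewrite !push_path_comp.
Qed.

Lemma ph_bridge (G : graph) (d : dart G) T2 x :
  path_homotopic (push_path (fold_map d T2) (split_bridge d T2 x)) [::].
Proof.
case: x => [x|] /=; first exact: ph_refl.
rewrite /push_path /dmap /= negbK.
by case: d => e []; exact: (ph_cancel [::] _ [::]).
Qed.

Lemma fold_unfold (G : graph) (d : dart G) (T2 : {set dart G}) :
  homotopy_inverse (fold_map d T2) (unfold_map d T2).
Proof.
set H := split_graph d T2; split; last first.
  exists (fun=> [::]) => [x|e]; first by rewrite /= eqxx.
  rewrite /= cats0 /split_edge.
  rewrite !push_path_cat push_path_rev.
  apply: ph_trans (ph_catr _ (ph_bridge d T2 _)) _.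
  apply: (@ph_trans _ _ ([:: (e, true)] ++ [::])); last exact: ph_refl.
  apply: (ph_catl [:: (e, true)]).
  case: (split_attach d T2 (e, false)) => [x|]; first exact: ph_refl.
  rewrite /push_path /dmap /=.
  by case: d @H => e' [] H; exact: (ph_cancel [::] _ [::]).
exists (split_bridge d T2) => [x|e]; first exact: split_bridgeP.
have cancelr (q : seq (dart H)) x :
    path_homotopic ((q ++ inv_path (split_bridge d T2 x)) ++ split_bridge d T2 x) q.
  by rewrite -catA -{2}[q]cats0; apply/ph_catl/ph_rev_l.
case: e => [e|] /=; rewrite /push_path /= cats0 /dmap /=.
  by rewrite /split_edge catA; exact: cancelr.
rewrite /split_edge; case: d @H cancelr => e [] H cancelr /=.
- rewrite (attach_d (e, true)) /=.
  apply: ph_trans (cancelr [:: (Some e, true)] _) _.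
  apply: ph_sym; exact: (@ph_cancel H [:: (Some e, true)] (None, false) [::]).
- rewrite (attach_d (e, false)) /= -catA.
  apply: ph_catl.
  exact: (@ph_cancel H [::] (Some e, true) [:: (None, true)]).
Qed.

Lemma split_marking_equiv (n : nat) (G : marked_graph n) (d : dart G) T2 :
  homotopy_equivalence (graph_comp (unfold_map d T2) (marking G)).
Proof.
have [g Hg] := marking_equiv G; have [H1 H2] := fold_unfold d T2.
exists (graph_comp g (fold_map d T2)).
by apply: homotopy_inverse_comp Hg _; split.
Qed.

Lemma cut_neighbor (G : graph) (C : finType) (gamma : C -> seq (dart G)) v d W :
  subgraph W (aug_whitehead gamma v) ->
  (exists2 t, t \in sedges W & d \in t) ->
  exists2 a, a != d & (a \in sverts W) && (ini a == v).
Proof.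
case=> HV HE Hin [t tW dt].
have := subsetP HE _ tW; rewrite /= inE in_set0 orbF inE.
case/exists_inP=> a Da /exists_inP[b Db /and3P[ab /eqP Et _]].
have Hv x : x \in t -> (x \in sverts W) && (ini x == v).
  move=> xt; rewrite (subsetP (Hin _ tW) _ xt) /=.
  rewrite !inE in Da Db.
  by move: xt; rewrite Et !inE => /orP[] /eqP->.
have [ta tb] : a \in t /\ b \in t by rewrite Et !inE !eqxx orbT.
move: dt; rewrite {1}Et !inE => /orP[]/eqP->.
- by exists b; [rewrite eq_sym | exact: Hv].
- by exists a; [| exact: Hv].
Qed.

Lemma valence_ge2 (G : graph) (x : vert G) a b :
  a != b -> ini a = x -> ini b = x -> valence x != 1.
Proof.
move=> ab ax bx; rewrite /valence neq_ltn orbC.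
have <- : #|[set a; b]| = 2 by rewrite cards2 ab.
apply/orP; left; apply: subset_leq_card.
by apply/subsetP => c; rewrite !inE => /orP[]/eqP->; apply/eqP.
Qed.

Lemma split_core (G : graph) (C : finType) (gamma : C -> seq (dart G))
    v d W1 W2 :
  is_cut gamma v d W1 W2 -> core_graph G ->
  core_graph (split_graph d (sverts W2)).
Proof.
case=> dW S1 S2 _ WI E1 E2 [conn val]; split=> [x y|x].
  have Px z := split_bridgeP d (sverts W2) z.
  have [p Hp] := conn (odflt (ini d) x) (odflt (ini d) y).
  exists (inv_path (split_bridge d (sverts W2) x)
          ++ push_path (unfold_map d (sverts W2)) p
          ++ split_bridge d (sverts W2) y).
  apply: is_path_cat (is_path_rev (Px x)) _; apply: is_path_cat (Px y).
  exact: (push_pathP (unfold_map d (sverts W2)) Hp).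
have dv : ini d = v by move: dW; rewrite !inE => /andP[/eqP].
have notW2 a : a != d -> a \in sverts W1 -> a \in sverts W2 = false.
  move=> ad a1; apply: contraNF ad => a2.
  have : a \in sverts (sinter W1 W2) by rewrite /= inE a1.
  by rewrite WI /= inE.
case: x => [x|].
  have [->|xv] := eqVneq x v.
    have [a ad /andP[aW /eqP av]] := cut_neighbor S1 E1.
    apply: (@valence_ge2 (split_graph d (sverts W2)) _
              (Some a.1, a.2) (Some d.1, d.2)).
    - apply: contra ad => /eqP[]; case: a {aW av} => ? ?; case: (d) => ? ?.
      by move=> /= -> ->.
    - rewrite ini_split /= -surjective_pairing /split_attach.
      by rewrite notW2 // !andbF av.
    - by rewrite ini_split /= -surjective_pairing attach_d dv.
  have := val x; rewrite /valence; apply: contra => /eqP H1.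
  have emb : [set (Some a.1, a.2) | a in directions x]
               \subset directions (Some x : vert (split_graph d (sverts W2))).
    apply/subsetP=> _ /imsetP[a ax ->]; move: ax; rewrite !inE => /eqP ax.
    rewrite ini_split /= -surjective_pairing /split_attach ax dv.
    by rewrite (negbTE xv).
  have inj : injective (fun a : dart G => (Some a.1, a.2)).
    by move=> [? ?] [? ?] /= [-> ->].
  have := subset_leq_card emb; rewrite H1 card_imset //.
  case E0 : #|directions x| => [|[|k]] // _.
  have /card_gt0P[[e b]] :
    0 < #|directions (Some x : vert (split_graph d (sverts W2)))|.
    by rewrite H1.
  rewrite inE ini_split /= => Hx.
  have [a ax] : exists a : dart G, a \in directions x.
    case: e Hx => [e|] /=.
      rewrite /split_attach; case: ifP => // _ /eqP[Hx].
      by exists (e, b); rewrite inE Hx.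
    case: ifP => // _; rewrite /split_attach; case: ifP => // _ /eqP[Hx].
    by exists (bar d); rewrite inE Hx.
  by move/cards0_eq: E0 ax => ->; rewrite inE.
have [a ad /andP[aW /eqP av]] := cut_neighbor S2 E2.
apply: (@valence_ge2 (split_graph d (sverts W2)) _ (Some a.1, a.2) (None, d.2)).
- by [].
- rewrite ini_split /= -surjective_pairing /split_attach.
  by rewrite ad aW av dv eqxx.
- by rewrite ini_split /= eqxx.
Qed.

(* The marked graph H. *)
Definition split_marked (n : nat) (G : marked_graph n) (C : finType)
    (gamma : C -> seq (dart G)) (v : vert G) (d : dart G)
    (W1 W2 : sgraph (dart G)) (cut : is_cut gamma v d W1 W2) :
    marked_graph n :=
  @MarkedGraph n (split_graph d (sverts W2))
    (graph_comp (unfold_map d (sverts W2)) (marking G))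
    (split_core cut (marked_core G))
    (split_marking_equiv d (sverts W2)).

(* Natural edges are represented by the sets of edges they consist of. *)
Definition natural_adjacent (G : graph) (e e' : edge G) : bool :=
  [exists x : vert G, ~~ natural_vertex x &&
     [exists b, exists b', (ini (e, b) == x) && (ini (e', b') == x)]].

Definition natural_edges (G : graph) : {set {set edge G}} :=
  equivalence_partition (connect (@natural_adjacent G)) [set: edge G].

Definition crossings (G : graph) (C : finType) (gamma : C -> seq (dart G))
    (e : edge G) : nat :=
  \sum_(i : C) count (fun a => a.1 == e) (gamma i).

(* For a circuit family, the number of crossings is constant along a natural
   edge. *)
Definition weight (G : graph) (C : finType) (gamma : C -> seq (dart G))
    (k : nat) : nat :=
  #|[set N in natural_edges G | [forall e in N, crossings gamma e == k]]|.

Definition weight_lt (w w' : nat -> nat) : Prop :=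
  exists k, (forall i, k < i -> w i = w' i) /\ w k < w' k.

Inductive data := Nil | Cons of data & data.

Definition hd (x : data) := if x is Cons l _ then l else Nil.
Definition tl (x : data) := if x is Cons _ r then r else Nil.

Fixpoint code_nat (n : nat) : data :=
  if n is n'.+1 then Cons Nil (code_nat n') else Nil.

Fixpoint fold_data (f g : data -> data) (p t : data) : data :=
  if t is Cons l r then
    g (Cons p (Cons t (Cons (fold_data f g p l) (fold_data f g p r))))
  else f p.

(* The total recursive functions on binary trees: the closure of the basic
   functions under composition, structural recursion and unbounded search
   (restricted to searches that succeed). *)
Inductive computable : (data -> data) -> Prop :=
| comp_id : computable id
| comp_nil : computable (fun=> Nil)
| comp_hd : computable hd
| comp_tl : computable tl
| comp_cons f g :
    computable f -> computable g -> computable (fun x => Cons (f x) (g x))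
| comp_comp f g : computable f -> computable g -> computable (f \o g)
| comp_rec f g : computable f -> computable g ->
    computable (fun x => fold_data f g (hd x) (tl x))
| comp_search f h : computable f ->
    (forall x, exists n,
       [/\ h x = code_nat n, f (Cons x (code_nat n)) = Nil &
           forall m, m < n -> f (Cons x (code_nat m)) <> Nil]) ->
    computable h
| comp_ext f g : f =1 g -> computable f -> computable g.

Definition code_seq (T : Type) (code : T -> data) (s : seq T) : data :=
  foldr (fun x => Cons (code x)) Nil s.

(* Elements of a finite type are coded by their position in its
   enumeration. *)
Definition code_fin (T : finType) (x : T) : data :=
  code_nat (index x (enum T)).

Definition code_dart (G : graph) (a : dart G) : data :=
  Cons (code_fin a.1) (code_nat a.2).

Definition code_path (G : graph) (p : seq (dart G)) : data :=
  code_seq (@code_dart G) p.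

Definition code_graph (G : graph) : data :=
  Cons (code_nat #|vert G|)
    (code_seq (fun e : edge G => Cons (code_fin (src e)) (code_fin (tgt e)))
       (enum (edge G))).

Definition code_map (G H : graph) (f : graph_map G H) : data :=
  Cons (code_seq (fun x => code_fin (vmap f x)) (enum (vert G)))
    (code_seq (fun e => code_path (emap f e)) (enum (edge G))).

Definition code_marked (n : nat) (G : marked_graph n) : data :=
  Cons (code_graph G) (code_map (marking G)).

Definition code_family (G : graph) (C : finType) (gamma : C -> seq (dart G)) :
  data := code_seq (fun i => code_path (gamma i)) (enum C).

Definition code_set (G : graph) (A : {set dart G}) : data :=
  code_path (enum A).

Definition code_sgraph (G : graph) (W : sgraph (dart G)) : data :=
  Cons (code_set (sverts W)) (code_seq (@code_set G) (enum (sedges W))).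

Definition code_input (n : nat) (G : marked_graph n) (C : finType)
    (gamma : C -> seq (dart G)) (W1 W2 : sgraph (dart G)) : data :=
  Cons (code_marked G)
    (Cons (code_family gamma) (Cons (code_sgraph W1) (code_sgraph W2))).

Definition code_output (n : nat) (H : marked_graph n) (G : graph)
    (f : graph_map H G) (C : finType) (delta : C -> seq (dart H)) : data :=
  Cons (code_marked H) (Cons (code_map f) (code_family delta)).

(* Main.v *)
From mathcomp Require Import all_boot.
Require Import Defs.

Set Implicit Arguments.
Unset Strict Implicit.
Unset Printing Implicit Defensive.

(* A dart a of gamma other than d and bar d has one dart of H over it.  A dart
   d or bar d has two, but only one of them fits the neighbouring dart on the
   other side of v: the turn there is an edge of the Whitehead graph, so it lies
   in exactly one part of the cut, and this decides between E_1 and E_2.  These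
   choices are consistent along gamma and give delta, and conversely they are
   forced on any lift, so delta is unique.

   The edge d.1, crossed k times, is replaced by E_1 and E_2, crossed k_1 and
   k_2 times, with k_1 + k_2 = k and k_1, k_2 > 0 since both parts of the cut
   have an edge at d.  A vertex of H of valence 2 is an endpoint v_1 or v_2, so
   natural edges of H that are not single edges of G contain E_1 or E_2 and are
   crossed fewer than k times.  Hence w_i is unchanged for i > k, and w_k drops
   by one. *)

(** * Lifting circuits to the split graph *)

Lemma bar_neq (G : graph) (a : dart G) : bar a != a.
Proof. by case: a => e []; rewrite /bar xpair_eqE andbF. Qed.

Lemma bar_eq (G : graph) (a b : dart G) : (bar a == b) = (a == bar b).
Proof. by rewrite (inv_eq (@barK G)). Qed.

(** Circuits are defined through [cycle], the turns they take through [zip c (rot 1 c)]; this passes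
    from one to the other. *)
Lemma cycle_all_zip (T : eqType) (e : rel T) (c : seq T) :
  cycle e c = all (fun p => e p.1 p.2) (zip c (rot 1 c)).
Proof.
case: c => //= x s; rewrite rot1_cons.
by elim: s x {2 4}x => [|y s IH] x z //=; rewrite IH.
Qed.

Lemma mem_zip_rot (T : eqType) (c : seq T) (a b : T) :
  (a, b) \in zip c (rot 1 c) -> a \in c /\ b \in c.
Proof.
move=> ab; have sz : size c = size (rot 1 c) by rewrite size_rot.
split.
  by rewrite -(@unzip1_zip _ _ c (rot 1 c)) ?sz //; apply: (map_f fst ab).
rewrite -(mem_rot 1) -(@unzip2_zip _ _ c (rot 1 c)) ?sz //.
exact: (map_f snd ab).
Qed.

Lemma zip_rot_map (S T : Type) (f : S -> T) (c : seq S) :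
  zip (map f c) (rot 1 (map f c)) =
    [seq (f p.1, f p.2) | p <- zip c (rot 1 c)].
Proof.
rewrite -map_rot; elim: c (rot 1 c) => [|x s IH] [|y t] //=.
by rewrite IH.
Qed.

Definition circuit_step (K : graph) : rel (dart K) :=
  [rel a b | (ter a == ini b) && (b != bar a)].

Lemma circuit_step_zip (K : graph) (c : seq (dart K)) a b :
  circuit c -> (a, b) \in zip c (rot 1 c) -> circuit_step a b.
Proof.
case/andP=> _; rewrite (@cycle_all_zip _ (@circuit_step K)) => /allP H.
exact: (H (a, b)).
Qed.

Section Lift.
Variables (G : graph) (d : dart G) (T2 : {set dart G}).
Local Notation H := (split_graph d T2).

Definition fold_dart (a : dart H) : dart G := (odflt d.1 a.1, a.2).

Lemma push_fold p : push_path (fold_map d T2) p = map fold_dart p.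
Proof. by elim: p => //= -[e []] p <-. Qed.

Lemma fold_dart_bar a : fold_dart (bar a) = bar (fold_dart a).
Proof. by []. Qed.

(** [E_1] and [E_2] start at a common vertex and part only at their ends over [d], so only a
    direction over [d] has an initial vertex that its image does not determine. *)
Lemma ini_fold_dart a :
  fold_dart a != d -> ini a = split_attach d T2 (fold_dart a).
Proof.
case: a => [[e|] b] ad; rewrite ini_split //=.
have ->: b = ~~ d.2; last by rewrite /fold_dart /bar; case: (d.2).
have: (d.1, b) != (d.1, d.2) by rewrite -surjective_pairing.
by rewrite xpair_eqE eqxx; case: (b) (d.2) => [] [].
Qed.

Lemma ini_over_dir a :
  fold_dart a = d -> ini a = if a.1 is Some _ then Some (ini d) else None.
Proof.
case: a => [[e|] b]; rewrite ini_split /fold_dart /= => E.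
  by rewrite E attach_d.
by rewrite -E eqxx.
Qed.

(* The vertex of H at which a lift of the subpath ab turns: d itself is attached
   to both v_1 and v_2, so the other direction of the turn decides. *)
Definition turn_end (a b : dart G) : option (vert G) :=
  split_attach d T2 (if bar a == d then b else bar a).

(** As the image does not backtrack, at most one direction of the turn lies over [d]; the other one
    fixes the vertex. *)
Lemma turn_endP (a b : dart H) :
    ter a = ini b -> fold_dart b != bar (fold_dart a) ->
  ini b = turn_end (fold_dart a) (fold_dart b).
Proof.
rewrite /turn_end -fold_dart_bar => E ba; case: eqVneq => [Ea|na].
  by rewrite -ini_fold_dart // -Ea.
by rewrite -E /ter ini_fold_dart.
Qed.

Lemma split_attach_Some a x : split_attach d T2 a = Some x -> x = ini a.
Proof. by rewrite /split_attach; case: ifP => // _ [->]. Qed.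

(** [p] and [q] are the neighbours of [a]. The dart [d] leaves [v], so its turn with [p] picks the
    copy; [bar d] arrives at [v], so its turn with [q] does. The default [Some (ini a)] merely
    selects the edge [Some a.1]. *)
Definition lift_dart (p a q : dart G) : dart H :=
  (if (if a == d then turn_end p a
       else if a == bar d then turn_end a q else Some (ini a))
   is Some _ then Some a.1 else None, a.2).

Fixpoint lift_walk (p : dart G) (c : seq (dart G)) (q : dart G) :
    seq (dart H) :=
  if c is a :: s then lift_dart p a (head q s) :: lift_walk a s q else [::].

Definition lift_circuit (c : seq (dart G)) : seq (dart H) :=
  if c is a :: s then lift_walk (last a s) c a else [::].

Lemma fold_lift_dart p a q : fold_dart (lift_dart p a q) = a.
Proof.
rewrite /fold_dart /=; case: eqVneq => [->|_]; last case: eqVneq => [->|_].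
- by case: (turn_end _ _) => //=; case: (d).
- by case: (turn_end _ _) => //=; case: (d).
- by case: (a).
Qed.

Lemma fold_lift_circuit c : map fold_dart (lift_circuit c) = c.
Proof.
have fold_walk p q t : map fold_dart (lift_walk p t q) = t.
  by elim: t p => //= a t IH p; rewrite fold_lift_dart IH.
by case: c => // a s; exact: fold_walk.
Qed.

(** Asking the images not to backtrack excludes the illegal turn of the fold together with
    backtracking in [H]. *)
Definition fold_step : rel (dart H) :=
  [rel a b | (ter a == ini b) && (fold_dart b != bar (fold_dart a))].

(** By [turn_endP] the images force the vertex where [a] meets its neighbour, and over [d] this
    vertex tells [E_1] from [E_2]. *)
Lemma lift_dart_fold p a q : fold_step p a -> fold_step a q ->
  lift_dart (fold_dart p) (fold_dart a) (fold_dart q) = a.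
Proof.
case/andP=> /eqP pa npa /andP[/eqP aq naq].
rewrite [RHS]surjective_pairing /lift_dart; congr (_, _).
case: (eqVneq (fold_dart a) d) => [Ed|nd].
  rewrite -(turn_endP pa npa) ini_over_dir // /fold_dart /=.
  by case: a.1.
case: eqVneq => [Ed|nd'].
  have Eb : fold_dart (bar a) = d by rewrite fold_dart_bar Ed barK.
  rewrite -(turn_endP aq naq) -aq /ter ini_over_dir // /fold_dart /=.
  by case: a.1.
(* Only a dart on [None] needs an argument: it lies over [d] or [bar d], and both are excluded
   here. *)
case: a nd nd' {pa npa aq naq} => [[e|] b] //= nd nd'.
have: (d.1, b) != (d.1, d.2) by rewrite -surjective_pairing.
have: (d.1, b) != (d.1, ~~ d.2) by [].
by rewrite !xpair_eqE eqxx; case: (b) (d.2) => [] [].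
Qed.

Lemma lift_walk_fold p c q : path fold_step p (rcons c q) ->
  lift_walk (fold_dart p) (map fold_dart c) (fold_dart q) = c.
Proof.
elim: c p => //= a c IH p /andP[pa path_a].
rewrite IH //; congr (_ :: _); case: c {IH} path_a => /= [|b c] /andP[ab _];
  exact: lift_dart_fold.
Qed.

Lemma lift_circuit_fold c : cycle fold_step c ->
  lift_circuit (map fold_dart c) = c.
Proof.
case: c => // a s cyc; rewrite [map _ _]/= /lift_circuit last_map.
apply: (@lift_walk_fold _ (a :: s)); rewrite rcons_cons .
by move: (cyc); rewrite /= rcons_path => /andP[-> ->].
Qed.

(* The last clause says that the turn (bar a, b) does not join the two parts of
   the cut; turns containing d are exempt, since d lies in both. *)
Definition lift_step : rel (dart G) :=
  [rel a b | [&& ter a == ini b, b != bar a &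
    (bar a != d) ==> (b != d) ==>
      (split_attach d T2 (bar a) == split_attach d T2 b)]].

(** If [a] is [d], its copy was chosen to start there. Otherwise either [bar p] is [d] and
    [turn_end] reads off [a], or the last clause of [lift_step] makes the attachments of [bar p] and
    [a] agree. With [ter_lift_dart], consecutive lifts meet. *)
Lemma ini_lift_dart p a q :
  lift_step p a -> ini (lift_dart p a q) = turn_end p a.
Proof.
case/and3P=> /eqP pa npa; have [Ed|nd] := eqVneq a d.
  have npd : bar p != d by rewrite -Ed eq_sym.
  move=> _; rewrite ini_over_dir ?fold_lift_dart // /lift_dart /= Ed eqxx.
  case E: (turn_end p d) => [x|] //; move: E.
  by rewrite /turn_end (negPf npd) => /split_attach_Some ->; rewrite -Ed -pa.
rewrite ini_fold_dart ?fold_lift_dart //= /turn_end.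
by case: eqVneq => //= _ /eqP.
Qed.

Lemma ter_lift_dart p a q :
  lift_step a q -> ter (lift_dart p a q) = turn_end a q.
Proof.
case/and3P=> /eqP aq naq _; have [Ed|nd] := eqVneq (bar a) d; last first.
  rewrite /ter ini_fold_dart fold_dart_bar fold_lift_dart //.
  by rewrite /turn_end (negPf nd).
have Ea : a = bar d by rewrite -Ed barK.
rewrite /ter ini_over_dir ?fold_dart_bar ?fold_lift_dart //.
rewrite /lift_dart /= Ea eqxx (negPf (bar_neq d)).
case E: (turn_end (bar d) q) => [x|] //; move: E.
rewrite /turn_end barK eqxx => /split_attach_Some ->.
by rewrite -aq /ter Ed.
Qed.

(** The dart [z] closes the walk; for a circuit it is the lift of the first dart again. *)
Lemma path_lift_walk p a s q (z : dart H) :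
    lift_step p a -> path lift_step a (rcons s q) ->
    ini z = turn_end (last a s) q -> fold_dart z = q ->
  path (@circuit_step H) (lift_dart p a (head q s)) (rcons (lift_walk a s q) z).
Proof.
have nb a1 (b b' : dart H) : lift_step a1 (fold_dart b') ->
    fold_dart b = a1 -> b' != bar b.
  case/and3P=> _ nb _ E; apply: contra nb => /eqP->.
  by rewrite fold_dart_bar E.
elim: s p a => [|b s IH] p a pa /= /andP[ab path_b] Ez zq.
  rewrite /circuit_step /= ter_lift_dart // Ez eqxx andbT /=.
  by apply: (nb a); rewrite ?fold_lift_dart ?zq.
rewrite IH // andbT /circuit_step /= ter_lift_dart // ini_lift_dart // eqxx.
by apply: (nb a); rewrite ?fold_lift_dart.
Qed.

Lemma cycle_lift_circuit c :
  cycle lift_step c -> cycle (@circuit_step H) (lift_circuit c).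
Proof.
case: c => // a s; rewrite [cycle _ _]/= => cyc.
have la : lift_step (last a s) a by move: cyc; rewrite rcons_path => /andP[].
rewrite [cycle _ _]/=; apply: path_lift_walk => //.
- exact: ini_lift_dart.
- exact: fold_lift_dart.
Qed.


End Lift.

(** * Natural edges and weights *)

Lemma connect_isolated (T : finType) (e : rel T) x y :
  (forall z, e x z -> x = z) -> connect e x y -> x = y.
Proof.
by move=> H /connectP[p pth ->]; elim: p pth => //= z p IH /andP[/H <-].
Qed.

Lemma natural_edgesE (K : graph) : natural_edges K =
  [set [set y | connect (@natural_adjacent K) x y] | x in [set: edge K]].
Proof. by apply: eq_imset => x; apply/setP=> y; rewrite !inE. Qed.

Section Crossings.
Variables (K : graph) (C : finType) (delta : C -> seq (dart K)).

Lemma crossings_gt0 i a : a \in delta i -> 0 < crossings delta a.1.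
Proof.
move=> ai; rewrite /crossings (bigD1 i) //= addn_gt0 -has_count.
by apply/orP; left; apply/hasP; exists a.
Qed.

Lemma crossings_darts e b : crossings delta e =
  \sum_(i : C) (count_mem (e, b) (delta i) + count_mem (e, ~~ b) (delta i)).
Proof.
apply: eq_bigr => i _; rewrite -count_predUI addnC.
rewrite (@eq_count _ (predI _ _) pred0) ?count_pred0 => [|a /=].
  apply: eq_count => -[e' b'] /=; rewrite !xpair_eqE.
  by case: eqP => //= _; case: b b' => [] [].
by apply/negbTE/andP => -[/eqP-> /eqP[]]; case: b.
Qed.

Hypothesis circ : forall i, circuit (delta i).

(* At a vertex with the two directions a and b only, a circuit that arrives
   against b leaves along a. *)
Lemma count_bivalent x a b i : directions x = [set a; b] ->
  count_mem a (delta i) = count_mem (bar b) (delta i).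
Proof.
move=> D; set c := delta i.
have sz : size c = size (rot 1 c) by rewrite size_rot.
have dir y : (ini y == x) = (y == a) || (y == b).
  by rewrite -in_set2 -D inE.
transitivity (count_mem a (rot 1 c)).
  by apply/esym/permP/permEl/perm_rot.
rewrite -[X in count _ X = _](@unzip2_zip _ _ c) ?sz //.
rewrite -[X in _ = count _ X](@unzip1_zip _ _ c (rot 1 c)) ?sz // !count_map.
apply: eq_in_count => -[p q] pq /=.
have /andP[/eqP tp np] := circuit_step_zip (circ i) pq.
rewrite -bar_eq; apply/eqP/eqP => [qa|pb].
  have: ini (bar p) == x by rewrite -/(ter p) tp dir qa eqxx.
  by rewrite dir -qa eq_sym (negPf np) => /eqP.
have: ini q == x by rewrite -tp /ter dir pb eqxx orbT.
by rewrite dir -pb (negPf np) orbF => /eqP.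
Qed.

(** If the edges differ, they provide the only two directions at [x], so every passage through [x]
    runs from one to the other; the orientations of [e] and [e'] are matched crosswise. *)
Lemma crossings_bivalent e e' :
  natural_adjacent e e' -> crossings delta e = crossings delta e'.
Proof.
case/existsP=> x /andP[nx /existsP[b /existsP[b' /andP[xb xb']]]].
have [-> //|ne] := eqVneq e e'.
have D : directions x = [set (e, b); (e', b')].
  apply/eqP; rewrite eq_sym eqEcard cards2 xpair_eqE (negPf ne) /=.
  rewrite leqNgt nx andbT; apply/subsetP => y.
  by rewrite !inE => /orP[]/eqP->.
rewrite (crossings_darts _ b) (crossings_darts _ b').
apply: eq_bigr => i _; rewrite (count_bivalent i D) addnC; congr (_ + _).
by rewrite (@count_bivalent x (e', b') (e, b)) // setUC.
Qed.

End Crossings.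

Section SplitWeight.
Variables (G : graph) (d : dart G) (T2 : {set dart G}).
Variables (C : finType) (gamma : C -> seq (dart G)).
Local Notation H := (split_graph d T2).
Variable delta : C -> seq (dart H).
Hypothesis natG : natural_structure G.
Hypothesis circ : forall i, circuit (delta i).
Hypothesis fold_delta : forall i, map (@fold_dart G d T2) (delta i) = gamma i.
Hypothesis cross1 : 0 < crossings delta (Some d.1 : edge H).
Hypothesis cross2 : 0 < crossings delta (None : edge H).

Lemma crossings_split : crossings gamma d.1 =
  crossings delta (Some d.1 : edge H) + crossings delta (None : edge H).
Proof.
rewrite /crossings -big_split; apply: eq_bigr => i _ /=.
rewrite -fold_delta count_map -count_predUI.
rewrite [X in _ + X](@eq_count _ _ pred0) ?count_pred0 ?addn0 => [|a /=].
  by apply: eq_count => -[[e|] b] /=; rewrite ?orbF ?eqxx ?orbT.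
by case: a => [[e|] b]; rewrite ?andbF.
Qed.

Lemma crossings_unsplit e : e != d.1 ->
  crossings delta (Some e : edge H) = crossings gamma e.
Proof.
move=> ne; apply: eq_bigr => i _; rewrite -fold_delta count_map.
by apply: eq_count => -[[e'|] b] //=; rewrite [RHS]eq_sym (negPf ne).
Qed.

Definition over_dir (e : edge H) : bool := odflt d.1 e == d.1.

(** Two distinct unsplit edges at [x] give two directions. At [v_1] and [v_2] the end of [E_1] or
    [E_2] is a third; any other vertex keeps all the directions it had in [G], where it is
    natural. *)
Lemma natural_adjacent_split e e' :
  natural_adjacent e e' -> [|| e == e', over_dir e | over_dir e'].
Proof.
case/existsP=> x /andP[nx /existsP[b /existsP[b' /andP[xb xb']]]].
have [//|ne /=] := eqVneq e e'; apply: contraR nx.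
rewrite negb_or => /andP[ed ed'].
have three (z : dart H) : over_dir z.1 -> ini z == x -> natural_vertex x.
  move=> zd zx; rewrite /natural_vertex /valence.
  have nz (y : dart H) : ~~ over_dir y.1 -> z != y.
    by apply: contraNneq => <-.
  have <- : #|z |: [set (e, b); (e', b')]| = 3.
    rewrite cardsU1 cards2 xpair_eqE (negPf ne) !inE negb_or.
    by rewrite !nz.
  apply/subset_leq_card/subsetP => y.
  by rewrite !inE => /or3P[]/eqP->.
case: x xb xb' three => [y|] _ _ three; last first.
  by apply: (three (None, d.2)); rewrite /over_dir /= ?ini_split /= ?eqxx.
have [Ey|ny] := eqVneq y (ini d).
  apply: (three (Some d.1, d.2)); rewrite /over_dir /= ?ini_split //=.
  by rewrite -surjective_pairing attach_d Ey.
apply: leq_trans (natG y) _; rewrite /valence.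
have inj : injective (fun a : dart G => (Some a.1, a.2)).
  by move=> [? ?] [? ?] /= [-> ->].
rewrite -(card_imset _ inj).
apply/subset_leq_card/subsetP => _ /imsetP[a ay ->].
move: ay; rewrite !inE => /eqP ay.
by rewrite ini_split /= -surjective_pairing /split_attach ay (negPf ny).
Qed.

(** Every vertex of [G] is natural, so each natural edge is a single edge. *)
Lemma weight_natural k : weight gamma k = #|[set e | crossings gamma e == k]|.
Proof.
rewrite -(card_imset _ (@set1_inj _)); apply: eq_card => N.
have class x : [set y | connect (@natural_adjacent G) x y] = [set x].
  apply/setP=> y; rewrite !inE; apply/idP/eqP => [|->]; last exact: connect0.
  move=> /connect_isolated <- // z /existsP[w /andP[]].
  by rewrite natG.
rewrite !inE natural_edgesE; apply/andP/imsetP => [[]|[e]].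
  case/imsetP=> e _ ->; rewrite class => /forall_inP H; exists e => //.
  by rewrite inE H // inE.
rewrite inE => ke ->; split.
  by apply/imsetP; exists e; rewrite ?class.
by apply/forall_inP => e'; rewrite inE => /eqP->.
Qed.

(** Natural adjacency preserves crossing numbers, so an edge crossed [k] times is not adjacent to
    [E_1] or [E_2] and forms a natural edge by itself. *)
Lemma weight_split k : crossings gamma d.1 <= k ->
  weight delta k = #|[set e | (e != d.1) && (crossings gamma e == k)]|.
Proof.
move=> lek.
have inj : injective (fun e : edge G => [set Some e : edge H]).
  by move=> e e' /set1_inj[].
rewrite -(card_imset _ inj); apply: eq_card => N.
(* Each of [E_1] and [E_2] is crossed fewer than [k] times, since the other is crossed at least
   once. *)
have notover x : crossings delta x = k -> ~~ over_dir x.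
  move=> xk; apply/negP => /eqP; case: x xk => [e|] /= xk ed; move: lek.
    by rewrite crossings_split -ed xk leqNgt -{1}[k]addn0 ltn_add2l cross2.
  by rewrite crossings_split xk leqNgt -{1}[k]add0n ltn_add2r cross1.
have class x : crossings delta x = k ->
    [set y | connect (@natural_adjacent H) x y] = [set x].
  move=> xk; apply/setP=> y; rewrite !inE; apply/idP/eqP => [|->]; last first.
    exact: connect0.
  move/connect_isolated => <- // z xz.
  move: (natural_adjacent_split xz); rewrite (negPf (notover _ xk)) /=.
  rewrite (crossings_bivalent circ xz) in xk.
  by rewrite (negPf (notover _ xk)) orbF => /eqP.
rewrite !inE natural_edgesE; apply/andP/imsetP => [[]|[e]].
  case/imsetP=> x _ -> /forall_inP Hx.
  have xk : crossings delta x = k by apply/eqP/Hx; rewrite inE connect0.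
  have := notover _ xk; rewrite class // /over_dir.
  case: x xk {Hx} => [e|] xk /=; last by rewrite eqxx.
  by move=> ed; exists e; rewrite // inE ed -crossings_unsplit // xk /=.
rewrite inE => /andP[ed /eqP ke] ->.
have xk : crossings delta (Some e : edge H) = k by rewrite crossings_unsplit.
split; last by apply/forall_inP => x; rewrite inE => /eqP->; apply/eqP.
by apply/imsetP; exists (Some e); rewrite ?class.
Qed.

Lemma weight_split_lt : weight_lt (weight delta) (weight gamma).
Proof.
(* Above this index [d.1] is counted on neither side; at the index itself it is counted for [gamma]
   only. *)
exists (crossings gamma d.1); split=> [i lti|].
  rewrite weight_split ?(ltnW lti) // weight_natural; apply: eq_card => e.
  rewrite !inE andb_idl // => /eqP ei.
  by apply: contraTneq lti => <-; rewrite ei ltnn.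
rewrite weight_split // weight_natural.
rewrite [in X in _ < X](cardsD1 d.1) inE eqxx add1n ltnS.
by apply/subset_leq_card; apply/subsetP => e; rewrite !inE.
Qed.

End SplitWeight.

(** * The circuit family of a cut *)

Section Cut.
Variables (G : graph) (C : finType) (gamma : C -> seq (dart G)).
Variables (v : vert G) (d : dart G) (W1 W2 : sgraph (dart G)).
Hypothesis cut : is_cut gamma v d W1 W2.
Hypothesis circ : forall i, circuit (gamma i).
Local Notation T2 := (sverts W2).
Local Notation H := (split_graph d T2).

Lemma cut_ini : ini d = v.
Proof. by have := cut_dir cut; rewrite !inE => /andP[/eqP]. Qed.

Lemma cut_common a : a \in sverts W1 -> a \in T2 -> a = d.
Proof.
move=> a1 a2; have : a \in sverts (sinter W1 W2) by rewrite inE a1.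
by rewrite (cut_inter cut) inE => /eqP.
Qed.

Lemma cut_attach a : ini a = v -> a != d ->
  split_attach d T2 a = if a \in T2 then None else Some v.
Proof. by move=> av ad; rewrite /split_attach av cut_ini eqxx ad. Qed.

(** A turn at [v] avoiding [d] is an edge of one part, which contains both its ends. As the parts
    meet only in [d], the two directions are both in [T2] or both outside. *)
Lemma cut_lift_step i : cycle (lift_step d T2) (gamma i).
Proof.
rewrite cycle_all_zip; apply/allP => -[a b] ab /=.
have /andP[tab nba] := circuit_step_zip (circ i) ab.
rewrite /lift_step /= tab nba /=; apply/implyP => nad; apply/implyP => nbd.
have [bv|nbv] := eqVneq (ini b) v; last first.
  rewrite /split_attach cut_ini -/(ter a) (eqP tab) (negPf nbv).
  by rewrite -(eqP tab).
have av : ini (bar a) = v by rewrite -/(ter a) (eqP tab).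
rewrite !cut_attach //.
pose t := [set bar a; b].
have: t \in sedges (aug_whitehead gamma v).
  rewrite !inE orbF; apply/existsP; exists (bar a); rewrite inE av eqxx /=.
  apply/existsP; exists b; rewrite inE bv eqxx eq_sym nba eqxx /=.
  by apply/existsP; exists i; rewrite barK [cyclic_subpath2 _ a b]ab.
have ta : bar a \in t by rewrite !inE eqxx.
have tb : b \in t by rewrite !inE eqxx orbT.
rewrite (cut_union cut) inE => /orP[tW|tW].
  have [_ _ /(_ _ tW) /subsetP sub] := cut_sub1 cut.
  have not2 x : x != d -> x \in t -> x \in T2 = false.
    by move=> xd xt; apply: contraNF xd => /(cut_common (sub _ xt)) ->.
  by rewrite !not2.
have [_ _ /(_ _ tW) /subsetP sub] := cut_sub2 cut.
by rewrite !sub.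
Qed.

(** Applied to [W1] and [W2], this yields the turns that force [E_1] and [E_2] to be crossed. *)
Lemma cut_turn W : subgraph W (aug_whitehead gamma v) ->
    (exists2 t, t \in sedges W & d \in t) ->
  exists x, [/\ x \in sverts W, x != d, ini x = v & takes_turn gamma d x].
Proof.
case=> _ /subsetP sE sV [t tW dt].
have := sE _ tW; rewrite inE in_set0 orbF inE.
case/exists_inP=> a av /exists_inP[b bv /and3P[ab /eqP Et turn]].
have sym x y : takes_turn gamma x y = takes_turn gamma y x.
  by apply: eq_existsb => i; rewrite orbC.
rewrite !inE in av bv; have /subsetP sub := sV _ tW.
move: dt; rewrite Et !inE => /orP[]/eqP->.
- exists b; split; rewrite 1?eq_sym ?(eqP bv) //.
  by apply: sub; rewrite Et !inE eqxx orbT.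
- exists a; split; rewrite ?(eqP av) // 1?sym //.
  by apply: sub; rewrite Et !inE eqxx.
Qed.

(** The lifted turn sits at the vertex where [x] is attached, and the only direction over [d] there
    belongs to [E_1] at [v_1] and to [E_2] at [v_2]. *)
Lemma cut_crosses (delta : C -> seq (dart H)) x :
    (forall i, circuit (delta i)) ->
    (forall i, map (@fold_dart G d T2) (delta i) = gamma i) ->
    x != d -> ini x = v -> takes_turn gamma d x ->
  0 < crossings delta (if x \in T2 then None else Some d.1 : edge H).
Proof.
move=> circd fold_delta xd xv turn.
suff [i [a [ai ad ax]]] : exists i, exists a : dart H,
    [/\ (a \in delta i) || (bar a \in delta i), fold_dart a = d &
        ini a = split_attach d T2 x].
  have <- : a.1 = if x \in T2 then None else Some d.1.
    move: ax; rewrite cut_attach // ini_over_dir //.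
    case: a ad {ai} => [[e|] b] /=; case: ifP => // _.
    by rewrite /fold_dart /= => <-.
  by case/orP: ai => /crossings_gt0.
case/existsP: turn => i; rewrite /cyclic_subpath2 -fold_delta zip_rot_map.
case/orP=> /mapP[[a b] ab E]; have Ea := congr1 fst E; have Eb := congr1 snd E;
  rewrite /= in Ea Eb;
  have /andP[/eqP tab _] := circuit_step_zip (circd i) ab;
  have [ai bi] := mem_zip_rot ab; exists i.
- exists (bar a); rewrite barK ai orbT fold_dart_bar -Ea barK; split=> //.
  by rewrite -/(ter a) tab Eb ini_fold_dart // -Eb.
- exists b; rewrite bi -Eb; split=> //.
  rewrite -tab /ter ini_fold_dart fold_dart_bar -Ea barK //.
Qed.

Definition cut_family (i : C) : seq (dart H) := lift_circuit d T2 (gamma i).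

(** Incidence of consecutive darts comes from the circuit in [H], absence of backtracking from its
    image. *)
Lemma circuit_fold (c : seq (dart H)) :
  circuit c -> circuit (map (@fold_dart G d T2) c) ->
  cycle (@fold_step G d T2) c.
Proof.
case/andP=> _ c1 /andP[_]; rewrite cycle_map => c2.
have := cycle_relI (@circuit_step H)
  (relpre (@fold_dart G d T2) (@circuit_step G)) c.
rewrite [cycle (@circuit_step H) c]c1 [cycle (relpre _ _) c]c2.
by apply: sub_cycle => a b /andP[/andP[ab _] /andP[_ nab]]; apply/andP.
Qed.

Lemma cut_family_fold i : map (@fold_dart G d T2) (cut_family i) = gamma i.
Proof. exact: fold_lift_circuit. Qed.

Lemma cut_family_circuit i : circuit (cut_family i).
Proof.
apply/andP; split; last exact/cycle_lift_circuit/cut_lift_step.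
rewrite -size_eq0 -(size_map (@fold_dart G d T2)) cut_family_fold size_eq0.
by case/andP: (circ i).
Qed.

Lemma circuit_equiv_map (K L : graph) (f : dart K -> dart L) c c' :
  circuit_equiv c c' -> circuit_equiv (map f c) (map f c').
Proof. by case=> k ->; exists k; rewrite map_rot. Qed.

(** The rotation carrying the image of [delta i] to [gamma i] is applied to [delta i] itself; the
    result folds onto [gamma i], hence is its lift. *)
Lemma cut_family_uniq (delta : C -> seq (dart H)) :
    (forall i, circuit (delta i)) ->
    family_equiv (fun i => push_path (fold_map d T2) (delta i)) gamma ->
  family_equiv delta cut_family.
Proof.
move=> circd eqv i; have [k] := eqv i; rewrite push_fold -map_rot => E.
exists k; rewrite /cut_family E lift_circuit_fold //.
apply: circuit_fold; last by rewrite -E.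
have := circd i; rewrite /circuit rot_cycle => /andP[ne ->].
by rewrite -size_eq0 size_rot size_eq0 ne.
Qed.

(** [E_1] and [E_2] have the same image, so taking their turn would make [gamma] backtrack. *)
Lemma cut_family_legal :
  ~~ takes_turn cut_family (split_E1 d T2) (split_E2 d T2).
Proof.
have backtrack i (a b : dart H) : fold_dart b = bar (fold_dart a) ->
    ~ (a, b) \in zip (cut_family i) (rot 1 (cut_family i)).
  move=> E ab.
  have: (fold_dart a, fold_dart b) \in zip (gamma i) (rot 1 (gamma i)).
    by rewrite -cut_family_fold zip_rot_map; apply/mapP; exists (a, b).
  by move/(circuit_step_zip (circ i))/andP => [_]; rewrite E eqxx.
apply/existsP => -[i /orP[] ab]; apply: backtrack ab.
- by rewrite fold_dart_bar barK.
- by rewrite fold_dart_bar barK.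
Qed.

End Cut.

(** * Computable operations on lists coded as right combs *)

(** Recursion runs along the right spine only: entries are not descended into, and [g] also sees the
    remaining suffix. *)
Fixpoint foldD (g : data -> data -> data -> data) (z l : data) : data :=
  if l is Cons a s then g a s (foldD g z s) else z.

Definition trueD : data := Cons Nil Nil.
(** Any tree other than [Nil] counts as true, so one test serves booleans, lists and codes of
    elements of option types. *)
Definition ifD (c a b : data) : data := foldD (fun _ _ _ => a) b c.
Definition mapD (F : data -> data) (l : data) : data :=
  foldD (fun a _ r => Cons (F a) r) Nil l.
(* Also truncated subtraction on codes of natural numbers, with the arguments
   reversed. *)
Definition dropD (n l : data) : data := foldD (fun _ _ r => tl r) l n.
Definition lenD (l : data) : data := mapD (fun=> Nil) l.
(* The index of an entry is the length of the list minus that of the suffix. *)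
Definition iotaD (l : data) : data :=
  foldD (fun _ s r => Cons (dropD (Cons Nil s) (lenD l)) r) Nil l.
Definition eqnD (m n : data) : data :=
  ifD (dropD m n) Nil (ifD (dropD n m) Nil trueD).

Lemma comp_app A B :
  computable A -> computable B -> computable (fun x => A (B x)).
Proof. exact: comp_comp. Qed.

Lemma comp_hdof A : computable A -> computable (fun x => hd (A x)).
Proof. exact: comp_comp comp_hd. Qed.

Lemma comp_tlof A : computable A -> computable (fun x => tl (A x)).
Proof. exact: comp_comp comp_tl. Qed.

Lemma comp_foldD (g : data -> data -> data -> data -> data) z l :
  computable
    (fun y => g (hd y) (hd (tl y)) (hd (tl (tl y))) (tl (tl (tl y)))) ->
  computable z -> computable l ->
  computable (fun x => foldD (g x) (z x) (l x)).
Proof.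
move=> Cg Cz Cl.
pose t y := hd (tl y).
have Ct : computable t by apply/comp_hdof/comp_tl.
(* [comp_rec] supplies the parameter, the whole tree and both recursive values; the value on the
   left subtree is discarded. *)
pose step y := g (hd y) (hd (t y)) (tl (t y)) (tl (tl (tl y))).
have Cstep : computable step.
  apply: (comp_app Cg (B := fun y => Cons (hd y)
            (Cons (hd (t y)) (Cons (tl (t y)) (tl (tl (tl y))))))).
  apply: comp_cons; first exact: comp_hd.
  apply: comp_cons; first exact: comp_hdof.
  apply: comp_cons; first exact: comp_tlof.
  by do 2!apply: comp_tlof; exact: comp_tl.
apply: comp_ext (comp_app (comp_rec Cz Cstep) (comp_cons comp_id Cl)) => x /=.
by elim: (l x) => //= a _ s ->.
Qed.

Create HintDb computable.
#[local] Hint Resolve comp_id comp_nil comp_cons comp_hdof comp_tlof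
  comp_foldD : computable.
#[local] Hint Extern 3 (computable _) =>
  match goal with
  | H : computable ?A |- computable (fun x => ?A (@?B x)) =>
      apply: (@comp_app A B)
  end : computable.

Ltac computability := auto 100 with computable nocore.

Lemma comp_ifD c a b : computable c -> computable a -> computable b ->
  computable (fun x => ifD (c x) (a x) (b x)).
Proof. by rewrite /ifD => *; computability. Qed.

Lemma comp_mapD (F : data -> data -> data) l :
  computable (fun y => F (hd y) (tl y)) -> computable l ->
  computable (fun x => mapD (F x) (l x)).
Proof.
move=> CF Cl; apply: comp_foldD => //; last by computability.
apply: comp_cons; last by computability.
apply: (comp_app CF (B := fun y => Cons (hd y) (hd (tl y)))).
by computability.
Qed.

Lemma comp_dropD n l : computable n -> computable l ->
  computable (fun x => dropD (n x) (l x)).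
Proof. by rewrite /dropD => *; computability. Qed.

#[local] Hint Resolve comp_ifD comp_mapD comp_dropD : computable.

Lemma comp_iotaD l : computable l -> computable (fun x => iotaD (l x)).
Proof. by rewrite /iotaD /lenD => *; computability. Qed.

Lemma comp_eqnD m n : computable m -> computable n ->
  computable (fun x => eqnD (m x) (n x)).
Proof. by rewrite /eqnD /trueD => *; computability. Qed.

#[local] Hint Resolve comp_iotaD comp_eqnD : computable.

Lemma ifD_bool (b : bool) x y : ifD (code_nat b) x y = if b then x else y.
Proof. by case: b. Qed.

Lemma mapD_seq (T : Type) (code : T -> data) F s :
  mapD F (code_seq code s) = code_seq (F \o code) s.
Proof. by elim: s => //= x s <-. Qed.

Lemma eq_code_seq (T : Type) (code code' : T -> data) s :
  code =1 code' -> code_seq code s = code_seq code' s.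
Proof. by move=> E; elim: s => //= x s ->; rewrite E. Qed.

Lemma code_seq_map (S T : Type) (h : S -> T) (code : T -> data) s :
  code_seq code (map h s) = code_seq (code \o h) s.
Proof. by elim: s => //= x s ->. Qed.

(** A number has the code of a list of that length, so list operations compute on numbers. *)
Lemma code_seq_iota_Nil n : code_seq (fun=> Nil) (iota 0 n) = code_nat n.
Proof. by elim: n 0 => //= n IH m; rewrite IH. Qed.

Lemma lenD_seq (T : Type) (code : T -> data) s :
  lenD (code_seq code s) = code_nat (size s).
Proof. by elim: s => //= x s <-. Qed.

Lemma foldD_tl (l : data) n :
  foldD (fun _ _ r => tl r) (tl l) n = tl (foldD (fun _ _ r => tl r) l n).
Proof. by elim: n => //= _ _ n ->. Qed.

Lemma dropD_seq (S T : Type) (cS : S -> data) (cT : T -> data) s t :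
  dropD (code_seq cS s) (code_seq cT t) = code_seq cT (drop (size s) t).
Proof.
elim: s t => [|x s IH] [|y t] //=; rewrite /dropD /= -foldD_tl /=.
- exact: (IH [::]).
- exact: IH.
Qed.

Lemma dropD_nat (T : Type) (code : T -> data) n s :
  dropD (code_nat n) (code_seq code s) = code_seq code (drop n s).
Proof. by rewrite -code_seq_iota_Nil dropD_seq size_iota. Qed.

Lemma eqnD_nat m n : eqnD (code_nat m) (code_nat n) = code_nat (m == n).
Proof.
rewrite /eqnD -[in X in ifD _ _ X](code_seq_iota_Nil m).
rewrite -[in X in ifD X](code_seq_iota_Nil n).
rewrite !dropD_nat.
have isnil k l : ifD (code_seq (fun=> Nil) (drop k (iota 0 l)))
    =2 (if l <= k then fun _ y => y else fun x _ => x).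
  case: leqP => lk x y; first by rewrite drop_oversize ?size_iota.
  case E : (drop k _) => //; move/(congr1 size): E.
  by rewrite size_drop size_iota /= => /eqP; rewrite subn_eq0 leqNgt lk.
by rewrite !isnil eqn_leq; case: (n <= m); case: (m <= n).
Qed.

Lemma iotaD_seq (T : Type) (code : T -> data) s :
  iotaD (code_seq code s) = code_seq code_nat (iota 0 (size s)).
Proof.
rewrite /iotaD lenD_seq -[code_nat _]code_seq_iota_Nil.
(* [r] is the part already passed; its length is the index of the next entry. *)
suff H t r : s = r ++ t ->
    foldD (fun _ s' w => Cons (dropD (Cons Nil s')
        (code_seq (fun=> Nil) (iota 0 (size s)))) w) Nil (code_seq code t)
      = code_seq code_nat (iota (size r) (size t)).
  exact: (H s [::]).
elim: t r => //= x t IH r E; rewrite (IH (rcons r x)) ?cat_rcons // size_rcons.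
congr Cons.
(* [dropD] ignores the entries of its first argument, so the head [Nil] may be replaced by the code
   of [x]. *)
rewrite -[LHS]/(dropD (code_seq code (x :: t)) (code_seq (fun=> Nil) _)).
rewrite dropD_seq drop_iota E size_cat /= addnK.
by elim: (size r) (_ + _) => //= n IHn m; rewrite IHn.
Qed.

Lemma iotaD_nat n : iotaD (code_nat n) = code_seq code_nat (iota 0 n).
Proof. by rewrite -[in LHS]code_seq_iota_Nil iotaD_seq size_iota. Qed.

Lemma map_index_uniq (T : eqType) (s : seq T) :
  uniq s -> [seq index x s | x <- s] = iota 0 (size s).
Proof.
move=> Us; apply: (@eq_from_nth _ 0) => [|i]; rewrite size_map ?size_iota //.
move=> lti; rewrite nth_iota // add0n.
by case: s Us lti => // x0 s Us lti; rewrite (nth_map x0) // index_uniq.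
Qed.

(** The algorithm knows elements only as positions, so such a list is generated from the cardinality
    alone. *)
Lemma code_seq_enum (T : finType) (code : data -> data) :
  code_seq (fun x : T => code (code_fin x)) (enum T) =
    code_seq (fun i => code (code_nat i)) (iota 0 #|T|).
Proof. by rewrite cardE -map_index_uniq ?enum_uniq // code_seq_map. Qed.

(** [None] comes first: [v_2] and [E_2] get position 0, coded [Nil], and all old positions shift by
    one, which is [Cons Nil] on codes. *)
Lemma enum_option (T : finType) :
  enum (option T : finType) = None :: map Some (enum T).
Proof. by rewrite !enumT [in LHS]unlock /= /option_enum. Qed.

Lemma code_fin_None (T : finType) : code_fin (None : option T) = Nil.
Proof. by rewrite /code_fin enum_option. Qed.

Lemma code_fin_Some (T : finType) (x : T) :
  code_fin (Some x) = Cons Nil (code_fin x).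
Proof.
rewrite /code_fin enum_option /= index_map //.
by move=> ? ? [].
Qed.

Lemma code_seq_option (T : finType) (code : option T -> data) :
  code_seq code (enum (option T : finType)) =
    Cons (code None) (code_seq (code \o Some) (enum T)).
Proof. by rewrite enum_option /= code_seq_map. Qed.

(** * The algorithm *)

Definition eqdD (a b : data) : data :=
  ifD (eqnD (hd a) (hd b)) (eqnD (tl a) (tl b)) Nil.
Definition memD (a l : data) : data :=
  foldD (fun b _ r => ifD (eqdD a b) trueD r) Nil l.
Definition barD (a : data) : data := Cons (hd a) (ifD (tl a) Nil trueD).
Definition iniD (es a : data) : data :=
  ifD (tl a) (hd (hd (dropD (hd a) es))) (tl (hd (dropD (hd a) es))).
Definition attachD (es d T2 a : data) : data :=
  ifD (ifD (eqnD (iniD es a) (iniD es d)) (ifD (eqdD a d) Nil (memD a T2)) Nil)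
    Nil (Cons Nil (iniD es a)).
Definition turn_endD (es d T2 a b : data) : data :=
  attachD es d T2 (ifD (eqdD (barD a) d) b (barD a)).
Definition lift_dartD (es d T2 p a q : data) : data :=
  Cons (ifD (ifD (eqdD a d) (turn_endD es d T2 p a)
              (ifD (eqdD a (barD d)) (turn_endD es d T2 a q) trueD))
          (Cons Nil (hd a)) Nil)
    (tl a).
Definition lastD (c : data) : data := foldD (fun a s r => ifD s r a) Nil c.
(* The entry p emits the lift of its successor, so that c is preceded by the
   dart before it and q is the dart after it. *)
Definition lift_walkD (es d T2 q c : data) : data :=
  foldD (fun p s r =>
    ifD s (Cons (lift_dartD es d T2 p (hd s) (ifD (tl s) (hd (tl s)) q)) r) Nil)
    Nil c.
Definition lift_circuitD (es d T2 c : data) : data :=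
  lift_walkD es d T2 (hd c) (Cons (lastD c) c).
Definition someD (a : data) : data := Cons (Cons Nil (hd a)) (tl a).
Definition split_graphD (es d T2 cG : data) : data :=
  Cons (Cons Nil (hd cG))
    (Cons (Cons (ifD (tl d) Nil (attachD es d T2 (barD d)))
                (ifD (tl d) (attachD es d T2 (barD d)) Nil))
       (mapD (fun i => Cons (attachD es d T2 (Cons i trueD))
                            (attachD es d T2 (Cons i Nil))) (iotaD es))).
(** Each dart is preceded by [bar E_1], [E_2] if it is attached to [v_2], and followed by the
    inverse path if its reversal is. *)
Definition unfoldD (es d T2 p : data) : data :=
  foldD (fun a _ r =>
    let bridge := ifD (attachD es d T2 (barD a)) r
      (Cons (Cons Nil (tl d)) (Cons (someD (barD d)) r)) in
    ifD (attachD es d T2 a) (Cons (someD a) bridge)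
      (Cons (someD d) (Cons (Cons Nil (tl (barD d))) (Cons (someD a) bridge))))
    Nil p.
Definition markingD (es d T2 m : data) : data :=
  Cons (mapD (Cons Nil) (hd m)) (mapD (unfoldD es d T2) (tl m)).
Definition fold_mapD (d cG : data) : data :=
  Cons (Cons (iniD (tl cG) d) (iotaD (hd cG)))
    (Cons (Cons (Cons (hd d) trueD) Nil)
       (mapD (fun i => Cons (Cons i trueD) Nil) (iotaD (tl cG)))).
(* The cut direction is the only direction common to both sides of the cut. *)
Definition meetD (S T : data) : data :=
  foldD (fun a _ r => ifD (memD a T) a r) Nil S.
Definition splitD (es d T2 cG m fam : data) : data :=
  Cons (Cons (split_graphD es d T2 cG) (markingD es d T2 m))
    (Cons (fold_mapD d cG) (mapD (lift_circuitD es d T2) fam)).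
Definition split_algorithm (x : data) : data :=
  splitD (tl (hd (hd x)))
    (meetD (hd (hd (tl (tl x)))) (hd (tl (tl (tl x))))) (hd (tl (tl (tl x))))
    (hd (hd x)) (tl (hd x)) (hd (tl x)).

Lemma comp_eqdD a b : computable a -> computable b ->
  computable (fun x => eqdD (a x) (b x)).
Proof. by rewrite /eqdD => *; computability. Qed.

Lemma comp_barD a : computable a -> computable (fun x => barD (a x)).
Proof. by rewrite /barD /trueD => *; computability. Qed.

Lemma comp_iniD es a : computable es -> computable a ->
  computable (fun x => iniD (es x) (a x)).
Proof. by rewrite /iniD => *; computability. Qed.

#[local] Hint Resolve comp_eqdD comp_barD comp_iniD : computable.

Lemma comp_memD a l : computable a -> computable l ->
  computable (fun x => memD (a x) (l x)).
Proof. by rewrite /memD /trueD => *; computability. Qed.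

#[local] Hint Resolve comp_memD : computable.

Lemma comp_attachD es d T2 a : computable es -> computable d -> computable T2 ->
  computable a -> computable (fun x => attachD (es x) (d x) (T2 x) (a x)).
Proof. by rewrite /attachD => *; computability. Qed.

#[local] Hint Resolve comp_attachD : computable.

Lemma comp_lift_dartD es d T2 p a q : computable es -> computable d ->
    computable T2 -> computable p -> computable a -> computable q ->
  computable (fun x => lift_dartD (es x) (d x) (T2 x) (p x) (a x) (q x)).
Proof. by rewrite /lift_dartD /turn_endD /trueD => *; computability. Qed.

#[local] Hint Resolve comp_lift_dartD : computable.

Lemma comp_split_algorithm : computable split_algorithm.
Proof.
rewrite /split_algorithm /splitD /split_graphD /markingD /fold_mapD /trueD.
rewrite /lift_circuitD /lift_walkD /lastD /unfoldD /someD /meetD.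
by computability.
Qed.

(** * Correctness of the algorithm on codes *)

Section Correct.
Variables (G : graph) (d : dart G) (T2 : {set dart G}).
Local Notation H := (split_graph d T2).

Definition code_edges : data :=
  code_seq (fun e : edge G => Cons (code_fin (src e)) (code_fin (tgt e)))
    (enum (edge G)).

Local Notation dD := (code_dart d).
Local Notation T2D := (code_set T2).

Lemma eqnD_fin (T : finType) (x y : T) :
  eqnD (code_fin x) (code_fin y) = code_nat (x == y).
Proof.
rewrite eqnD_nat; congr (code_nat (nat_of_bool _)); apply/eqP/eqP => [|->] //.
by apply: (index_inj x); rewrite mem_enum.
Qed.

Lemma eqdDE (K : graph) (a b : dart K) :
  eqdD (code_dart a) (code_dart b) = code_nat (a == b).
Proof.
rewrite /eqdD /= eqnD_fin eqnD_nat ifD_bool [a == b]/eq_op /=.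
by case: (a.1 == b.1); case: (a.2) (b.2) => [] [].
Qed.

Lemma memDE (K : graph) (a : dart K) s :
  memD (code_dart a) (code_path s) = code_nat (a \in s).
Proof.
elim: s => //= b s IH; rewrite inE -[LHS]/(ifD _ _ (memD _ (code_path s))) IH.
by rewrite eqdDE ifD_bool; case: (a == b).
Qed.

Lemma barDE (K : graph) (a : dart K) : barD (code_dart a) = code_dart (bar a).
Proof. by case: a => e []. Qed.

Lemma iniDE (a : dart G) : iniD code_edges (code_dart a) = code_fin (ini a).
Proof.
rewrite /iniD /code_edges /= dropD_nat drop_index ?mem_enum //= ifD_bool /ini.
by case: a.2.
Qed.

Lemma code_vert (x : option (vert G)) :
  code_fin (x : vert H) = if x is Some y then Cons Nil (code_fin y) else Nil.
Proof.
by case: x => [x|];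
  rewrite ?(@code_fin_Some (vert G)) // (@code_fin_None (vert G)).
Qed.

Lemma code_edge (e : option (edge G)) :
  code_fin (e : edge H) = if e is Some e' then Cons Nil (code_fin e') else Nil.
Proof.
by case: e => [x|];
  rewrite ?(@code_fin_Some (edge G)) // (@code_fin_None (edge G)).
Qed.

Lemma attachDE (a : dart G) : attachD code_edges dD T2D (code_dart a) =
  code_fin (split_attach d T2 a : vert H).
Proof.
rewrite /attachD !iniDE eqnD_fin eqdDE /code_set memDE mem_enum !ifD_bool.
rewrite code_vert /split_attach.
by do 2![case: eqP => _ //=]; case: (a \in T2).
Qed.

Lemma turn_endDE (a b : dart G) :
  turn_endD code_edges dD T2D (code_dart a) (code_dart b) =
    code_fin (turn_end d T2 a b : vert H).
Proof.
by rewrite /turn_endD barDE eqdDE ifD_bool -attachDE /turn_end; case: eqP.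
Qed.

Lemma ifD_vert (x : option (vert G)) a b :
  ifD (code_fin (x : vert H)) a b = if x is Some _ then a else b.
Proof. by rewrite code_vert; case: x. Qed.

Lemma lift_dartDE (p a q : dart G) :
  lift_dartD code_edges dD T2D (code_dart p) (code_dart a) (code_dart q) =
    code_dart (lift_dart d T2 p a q).
Proof.
rewrite /lift_dartD barDE !eqdDE !turn_endDE !ifD_bool /code_dart /lift_dart /=.
congr Cons; rewrite code_edge.
by case: eqP => _; rewrite ?ifD_vert; last case: eqP => _;
  rewrite ?ifD_vert //; case: (turn_end _ _ _ _).
Qed.

Lemma lift_circuitDE (c : seq (dart G)) :
  lift_circuitD code_edges dD T2D (code_path c) =
    code_path (lift_circuit d T2 c).
Proof.
case: c => [//|a s]; rewrite /lift_circuitD /lift_circuit.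
have -> : lastD (code_path (a :: s)) = code_dart (last a s).
  by elim: s a => [//|b s IH] a; rewrite -IH.
have walk q p t : lift_walkD code_edges dD T2D (code_dart q)
    (Cons (code_dart p) (code_path t)) = code_path (lift_walk d T2 p t q).
  elim: t p => [//|b t IH] p.
  rewrite -[LHS]/(Cons _ (lift_walkD _ _ _ _
    (Cons (code_dart b) (code_path t)))).
  rewrite IH [RHS]/=; congr Cons; rewrite -lift_dartDE.
  by case: (t).
exact: walk.
Qed.

Lemma someDE (a : dart G) :
  someD (code_dart a) = code_dart ((Some a.1, a.2) : dart H).
Proof. by rewrite /code_dart code_edge. Qed.

Lemma split_graphDE :
  split_graphD code_edges dD T2D (code_graph G) = code_graph H.
Proof.
rewrite /split_graphD /code_graph; congr Cons.
  by rewrite /= card_option.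
rewrite (@code_seq_option (edge G)) -/code_edges; congr Cons.
  rewrite barDE attachDE /= /src /tgt /=.
  by case: (d.2); rewrite !ifD_bool /= (@code_fin_None (vert G)).
rewrite iotaD_seq mapD_seq -cardE.
rewrite -(@code_seq_enum _ (fun i =>
  Cons (attachD code_edges dD T2D (Cons i trueD))
    (attachD code_edges dD T2D (Cons i Nil)))).
apply: eq_code_seq => e /=.
rewrite -[Cons _ trueD]/(code_dart (e, true)).
by rewrite -[Cons _ Nil]/(code_dart (e, false)) !attachDE.
Qed.

(** The formula for [split_edge] is symmetric under reversal, so [unfoldD] can treat both
    orientations alike. *)
Lemma dmap_unfold (a : dart G) : dmap (unfold_map d T2) a =
  split_bridge d T2 (split_attach d T2 a) ++ ((Some a.1, a.2) : dart H) ::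
    inv_path (split_bridge d T2 (split_attach d T2 (bar a))).
Proof.
case: a => e [] //; rewrite /dmap /= /split_edge !inv_path_cat inv_pathK.
by rewrite -catA.
Qed.

Lemma unfoldDE (p : seq (dart G)) :
  unfoldD code_edges dD T2D (code_path p) =
    code_path (push_path (unfold_map d T2) p).
Proof.
elim: p => [//|a p IH].
rewrite -[push_path _ (a :: p)]/(dmap (unfold_map d T2) a ++ push_path _ p).
rewrite dmap_unfold.
pose aD := code_dart a.
rewrite -[LHS]/(let r := unfoldD code_edges dD T2D (code_path p) in
    let bridge := ifD (attachD code_edges dD T2D (barD aD)) r
      (Cons (Cons Nil (tl dD)) (Cons (someD (barD dD)) r)) in
    ifD (attachD code_edges dD T2D aD) (Cons (someD aD) bridge)
      (Cons (someD dD)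
        (Cons (Cons Nil (tl (barD dD))) (Cons (someD aD) bridge)))).
rewrite {}/aD; lazy zeta; rewrite IH !barDE !attachDE !someDE !ifD_vert.
have E2 (b : bool) : Cons Nil (code_nat b) = code_dart ((None, b) : dart H).
  by rewrite /code_dart code_edge.
rewrite /= !E2.
case: (split_attach d T2 a) => [x|];
  case: (split_attach d T2 (bar a)) => [y|] //=;
  by rewrite /inv_path /= /bar /= !negbK -?surjective_pairing.
Qed.

Lemma fold_mapDE : fold_mapD dD (code_graph G) = code_map (fold_map d T2).
Proof.
rewrite /fold_mapD /code_map.
rewrite (@code_seq_option (edge G)) (@code_seq_option (vert G)) iniDE /=.
rewrite iotaD_nat -/code_edges iotaD_seq mapD_seq -cardE.
rewrite -(@code_seq_enum (vert G) id).
rewrite -(@code_seq_enum (edge G) (fun i => Cons (Cons i trueD) Nil)).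
by [].
Qed.

Lemma markingDE (K : graph) (m : graph_map K G) :
  markingD code_edges dD T2D (code_map m) =
    code_map (graph_comp (unfold_map d T2) m).
Proof.
rewrite /markingD /code_map /= !mapD_seq; congr Cons.
  by apply: eq_code_seq => x /=; rewrite code_vert.
by apply: eq_code_seq => e; rewrite /= unfoldDE.
Qed.

End Correct.

Lemma splitDE (n : nat) (G : marked_graph n) (C : finType)
    (gamma : C -> seq (dart G)) v d W1 W2 (cut : is_cut gamma v d W1 W2) :
  split_algorithm (code_input gamma W1 W2) =
    code_output (H := split_marked cut) (fold_map d (sverts W2))
      (cut_family gamma d W2).
Proof.
have dE : meetD (code_set (sverts W1)) (code_set (sverts W2)) = code_dart d.
  have : d \in enum (sverts W1).
    have : d \in sverts (sinter W1 W2) by rewrite (cut_inter cut) inE.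
    by rewrite inE mem_enum => /andP[].
  have d2 : d \in sverts W2.
    have : d \in sverts (sinter W1 W2) by rewrite (cut_inter cut) inE.
    by rewrite inE => /andP[].
  (* The vertices of [W1] are scanned in order; the first one found in [W2] must be [d]. *)
  have : {subset enum (sverts W1) <= sverts W1} by move=> x; rewrite mem_enum.
  rewrite {1}/code_set; elim: (enum (sverts W1)) => //= a s IH sub ds.
  rewrite -[LHS]/(ifD _ _ (meetD (code_path s) _)) memDE mem_enum ifD_bool.
  case: ifP => a2.
    by rewrite (cut_common cut _ a2) // sub ?inE ?eqxx.
  apply: IH => [x xs|]; first by rewrite sub // inE xs orbT.
  by move: ds; rewrite inE => /predU1P[E|//]; rewrite -E d2 in a2.
rewrite /split_algorithm /code_input /splitD /= dE -/(code_edges G).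
rewrite /code_output /code_marked /=.
congr (Cons (Cons _ _) (Cons _ _)).
- exact: split_graphDE.
- exact: markingDE.
- exact: fold_mapDE.
- rewrite mapD_seq; apply: eq_code_seq => i; exact: lift_circuitDE.
Qed.

Theorem proposition2p5p4 :
  exists2 algorithm : data -> data, computable algorithm &
  forall (n : nat) (G : marked_graph n) (C : finType)
         (gamma : C -> seq (dart G)) (v : vert G) (d : dart G)
         (W1 W2 : sgraph (dart G)) (cut : is_cut gamma v d W1 W2),
    2 <= n ->
    natural_structure G ->
    circuit_family gamma ->
    let H : marked_graph n := split_marked cut in
    let f : graph_map H G := fold_map d (sverts W2) in
    let E1 : dart H := split_E1 d (sverts W2) in
    let E2 : dart H := split_E2 d (sverts W2) in
    let lifts (delta : C -> seq (dart H)) : Prop :=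
      [/\ circuit_family delta,
          ~~ takes_turn delta E1 E2 &
          family_equiv (fun i => push_path f (delta i)) gamma] in
    exists delta : C -> seq (dart H),
      [/\ lifts delta,
          forall delta', lifts delta' -> family_equiv delta' delta,
          weight_lt (weight delta) (weight gamma) &
          algorithm (code_input gamma W1 W2) = code_output f delta].
Proof.
exists split_algorithm; first exact: comp_split_algorithm.
move=> n G C gamma v d W1 W2 cut _ natG [circ inequiv] H f E1 E2 lifts.
pose delta := cut_family gamma d W2.
have circd : forall i, circuit (delta i) by exact: cut_family_circuit cut circ.
have fold_delta := cut_family_fold gamma d W2.
exists delta; split.
- split; last 2 first.
  + exact: cut_family_legal.
  + by move=> i; exists 0; rewrite rot0 push_fold fold_delta.
  (* Equivalent lifts would fold to equivalent components of [gamma]. *)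
  split=> // i j ij /(circuit_equiv_map (@fold_dart G d (sverts W2))).
  by rewrite !fold_delta; exact: inequiv.
- by move=> delta' [[circ' _] _ eqv]; exact: cut_family_uniq eqv.
- apply: (weight_split_lt natG circd fold_delta).
  (* A turn of [W1] at [d] has its other end outside [T2] and forces [E_1] to be crossed; one of
     [W2] forces [E_2]. *)
  + have [x [x1 xd xv turn]] := cut_turn (cut_sub1 cut) (cut_edge1 cut).
    have := cut_crosses cut circd fold_delta xd xv turn.
    by case: ifP => // x2; rewrite (cut_common cut x1 x2) eqxx in xd.
  + have [x [x2 xd xv turn]] := cut_turn (cut_sub2 cut) (cut_edge2 cut).
    by have := cut_crosses cut circd fold_delta xd xv turn; rewrite x2.
- exact: splitDE.
Qed.
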